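(* Let $L^{\mathcal O}=(A^{\mathcal O},B^{\mathcal O},(\mathcal O,\sqsubseteq^{\mathcal O},\sqcup^{\mathcal O}),O_0,\tau^{\mathcal O},\delta^{\mathcal O})$ be an (object) L-ADT, $L^{\mathcal C}=(A^{\mathcal C},B^{\mathcal C},(\mathcal C,\sqsubseteq^{\mathcal C},\sqcup^{\mathcal C}),C_0,\tau^{\mathcal C},\delta^{\mathcal C})$ a configuration L-ADT, and $L=L^{\mathcal O}\times L^{\mathcal C}$ their composition. Then the algorithm $\mathcal B$ described in the context, which uses a reconfigurable lattice agreement object on $\mathcal O\times\mathcal C$, is a reconfigurable implementation of $L$: every history of $\mathcal B$ is interval-linearizable with respect to the interval-sequential specification $\mathcal S_L$ of $L$, and, under the Configuration availability assumption, in every execution with finitely many distinct proposed configurations, every operation invoked by a correct client eventually returns.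
   Context: **L-ADT.** An L-ADT is a tuple $(A,B,(Z,\sqsubseteq^Z,\sqcup^Z),z_0,\tau,\delta)$, where $A$ (inputs), $B$ (outputs), $Z$ (states) are countable sets, $(Z,\sqsubseteq^Z)$ is a join semi-lattice with join $\sqcup^Z$, $z_0\in Z$ is the initial state, $\tau:Z\times A\to Z$ is the transition function and $\delta:Z\times A\to B$ the output function, such that $z\sqsubseteq^Z\tau(z,a)$ for all $z\in Z,a\in A$, and $\tau(\tau(z,a),a')=\tau(z,a)\sqcup^Z\tau(z,a')=\tau(\tau(z,a'),a)$ for all $z\in Z$, $a,a'\in A$. **Composition.** $L^{\mathcal O}\times L^{\mathcal C}$ has inputs the disjoint union $A^{\mathcal O}+A^{\mathcal C}$, outputs $B^{\mathcal O}\cup B^{\mathcal C}$, states $\mathcal O\times\mathcal C$ with product order and join, initial state $(O_0,C_0)$; transition and output functions apply $\tau^{\mathcal O},\delta^{\mathcal O}$ to the first component for inputs in $A^{\mathcal O}$ and $\tau^{\mathcal C},\delta^{\mathcal C}$ to the second for inputs in $A^{\mathcal C}$. **Configuration L-ADT.** An L-ADT $L^{\mathcal C}$ such that each state $C\in\mathcal C$ has a set $\mathit{members}(C)\subseteq\Pi$ ($\Pi$ the set of processes) and a set $\mathit{quorums}(C)\subseteq 2^{\mathit{members}(C)}$, any two elements of which intersect (both returned by query operations in $A^{\mathcal C}$, i.e., operations that do not change the state). **Interval-sequential specification.** An interval-sequential history is a sequence $z_0,I_1,R_1,z_1,\dots,I_m,R_m,z_m$ with states $z_i\in Z$, sets $I_i$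 of inputs and $R_i$ of outputs, each labeled with a process and an operation identifier. For an L-ADT $L$, $\mathcal S_L$ is the set of those (well-formed) interval-sequential histories such that, for all $i=1,\dots,m$: $z_i=\bigsqcup^Z_{a\in I_i}\tau(z_{i-1},a)$ (with $z_i=z_{i-1}$ if $I_i=\emptyset$), and every $r\in R_i$ equals $\delta(z_i,a)$, where $a$ is the invocation matching $r$. **Interval-linearizability.** Histories are sequences of labeled inputs and outputs. They are well-formed: a process invokes an operation only after its previous one has returned and every response is preceded by its matching invocation. A history $H$ is interval-linearizable with respect to $\mathcal S$ if it can be completed (adding matching responses to incomplete operations) to a history $\bar H$ for which there is an interval-sequential history $S$ such that (1) $\bar H|p=S|p$ for every process $p$ (equal projections on $p$); (2) $S\in\mathcal S$; (3) $\rightarrow_H\subseteq\rightarrow_S$, where $\rightarrow$ is the real-time precedence relation (the response of the first operation occurs before the invocation of the second). **Reconfigurable lattice agreement (RLA)** on $\mathcal L=\mathcal O\times\mathcal C$ with product order $\sqsubseteq$: an object with an operation $\mathit{propose}:\mathcal L\to\mathcal L$; a client proposes the argument and learns the returned value. It satisfies: *Validity*: if $\mathit{propose}(v)$ returns $v'$, then $v'$ is a join of some proposed values (the initial state $(O_0,C_0)$ being allowed in the join) including $v$ and all values learnt before the invocation of the operation; *Consistency*: learnt values are totally ordered by $\sqsubseteq$; *Reconfigurable Liveness* (under Configuration availability): in executions with finitely many distinct proposed configurations, every propose operation invoked by a correct client eventually returns. **Failure assumptions.** Processes may crash. A client is correct if it does not fail while executing an operation. A configuration $C$ is potential if it is the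 join of $C_0$ with finitely many proposed configurations; it is superseded once some process learns $( *,C')$ with $C\sqsubseteq^{\mathcal C}C'$, $C\ne C'$; it is active when potential and not yet superseded. A replica is correct if from some point on it is forever a member of an active configuration and not failed. $C$ is available if some $Q\in\mathit{quorums}(C)$ contains only correct processes. *Configuration availability*: every potential configuration that is never superseded is available. **Algorithm $\mathcal B$ (code for process $p$).** Shared: an RLA object. Local: $O_p$, initially $O_0$; $C_p$, initially $C_0$. Upon invocation of $a\in A^{\mathcal O}$: $(O_p,C_p):=\mathrm{RLA}.\mathit{propose}((\tau^{\mathcal O}(O_p,a),C_p))$; return $\delta^{\mathcal O}(O_p,a)$. Upon invocation of $a\in A^{\mathcal C}$: $(O_p,C_p):=\mathrm{RLA}.\mathit{propose}((O_p,\tau^{\mathcal C}(C_p,a)))$; return $\delta^{\mathcal C}(C_p,a)$.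
   Formalization: Validity is strengthened: the returned join must lie above all values learnt before the invocation of every propose contributing to it, not just the returning one (the literal clause fails for a max register); processes are assumed to eventually take enabled steps for liveness. *)

(* Defs.v *)
From HB Require Import structures.
From mathcomp Require Import all_boot all_order.
From mathcomp Require Import boolp classical_sets functions cardinality.

Set Implicit Arguments.
Unset Strict Implicit.
Unset Printing Implicit Defensive.

Import Order.TTheory.
Local Open Scope classical_set_scope.

(* Outputs are a subset of an ambient type U, so that the outputs of a
   composition are a genuine (not necessarily disjoint) union. *)
Record LADT (U : eqType) (d : Order.disp_t) := MkLADT {
  input : countType;
  output : set U;
  state : joinSemilatticeType d;
  init : state;
  tau : state -> input -> state;
  delta : state -> input -> U;
  output_countable : countable output;
  state_countable : countable [set: state];
  delta_output : forall z a, output (delta z a);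
  tau_ge : forall z a, (z <= tau z a)%O;
  tau_join : forall z a a', tau (tau z a) a' = Order.join (tau z a) (tau z a');
  tau_joinC : forall z a a', Order.join (tau z a) (tau z a') = tau (tau z a') a
}.

Section Composition.
Variables (U : eqType) (d1 d2 : Order.disp_t).
Variables (L1 : LADT U d1) (L2 : LADT U d2).

Let Z := (state L1 *p state L2)%type.

Definition prod_tau (z : Z) (a : input L1 + input L2) : Z :=
  match a with
  | inl a1 => (tau z.1 a1, z.2)
  | inr a2 => (z.1, tau z.2 a2)
  end.

Definition prod_delta (z : Z) (a : input L1 + input L2) : U :=
  match a with
  | inl a1 => delta z.1 a1
  | inr a2 => delta z.2 a2
  end.

Fact prod_output_countable : countable (output L1 `|` output L2).
Proof.
have -> : output L1 `|` output L2 =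
    \bigcup_(b in [set: bool]) (if b then output L1 else output L2).
  rewrite predeqE => u; split=> [[h|h]|[[] _ h]].
  - by exists true.
  - by exists false.
  - by left.
  - by right.
apply: bigcup_countable => [|[] _]; first exact: countableP.
- exact: output_countable.
- exact: output_countable.
Qed.

Fact prod_state_countable : countable [set: Z].
Proof.
rewrite -[[set: Z]]/([set: state L1 * state L2]) -setXTT.
by apply: countableX; exact: state_countable.
Qed.

Fact prod_delta_output z a : (output L1 `|` output L2) (prod_delta z a).
Proof. by case: a => a; [left|right]; exact: delta_output. Qed.

Fact prod_tau_ge (z : Z) a : (z <= prod_tau z a)%O.
Proof. by case: z a => z1 z2 [] a; rewrite leEprod /= lexx tau_ge. Qed.

Fact prod_tau_join (z : Z) a a' :
  prod_tau (prod_tau z a) a' = Order.join (prod_tau z a) (prod_tau z a').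
Proof.
case: z a a' => z1 z2 [] a [] a'; rewrite joinEprod /= ?joinxx ?tau_join //;
  by congr pair; rewrite ?(join_l (tau_ge _ _)) ?(join_r (tau_ge _ _)).
Qed.

Fact prod_tau_joinC (z : Z) a a' :
  Order.join (prod_tau z a) (prod_tau z a') = prod_tau (prod_tau z a') a.
Proof. by rewrite prod_tau_join joinC. Qed.

Definition ladt_prod : LADT U (Order.prod_display d1 d2) :=
  @MkLADT U _ (input L1 + input L2)%type (output L1 `|` output L2) Z
    (init L1, init L2) prod_tau prod_delta
    prod_output_countable prod_state_countable prod_delta_output
    prod_tau_ge prod_tau_join prod_tau_joinC.
End Composition.

(* The two query inputs do not change the state, and their outputs determine
   members and quorums; an output is an element of U, and members_of and
   quorums_of say how to read it as a set of processes, resp. as a family of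
   such sets. *)
Record configLADT (Pi U : eqType) (d : Order.disp_t) := MkConfigLADT {
  config_ladt :> LADT U d;
  members : state config_ladt -> set Pi;
  quorums : state config_ladt -> set (set Pi);
  quorums_members : forall C Q, quorums C Q -> Q `<=` members C;
  quorums_meet : forall C Q Q', quorums C Q -> quorums C Q' -> Q `&` Q' !=set0;
  members_query : input config_ladt;
  quorums_query : input config_ladt;
  members_of : U -> set Pi;
  quorums_of : U -> set (set Pi);
  tau_members_query : forall C, tau C members_query = C;
  tau_quorums_query : forall C, tau C quorums_query = C;
  delta_members_query : forall C,
    members_of (delta C members_query) = members C;
  delta_quorums_query : forall C,
    quorums_of (delta C quorums_query) = quorums C
}.

(* An operation is identified by its process and an operation identifier. *)
Definition label (Pi : eqType) := (Pi * nat)%type.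

(* (l, inl a) is the invocation of operation l with input a, and (l, inr b) is
   its response with output b. *)
Definition action (Pi A U : eqType) := (label Pi * (A + U))%type.

Section Histories.
Variables Pi A U : eqType.
Implicit Types H : seq (action Pi A U).

Definition is_response (x : action Pi A U) :=
  if x.2 is inr _ then true else false.

Definition proj (p : Pi) H := [seq x <- H | x.1.1 == p].

Fixpoint alternating H : bool :=
  match H with
  | [::] => true
  | [:: (_, inl _)] => true
  | (l, inl _) :: (l', inr _) :: H' => (l == l') && alternating H'
  | _ => false
  end.

Definition well_formed H :=
  uniq [seq x.1 | x <- H & ~~ is_response x] /\
  forall p, alternating (proj p H).

Definition complete H :=
  forall l a, (l, inl a) \in H -> exists b, (l, inr b) \in H.

Definition precedes H (l l' : label Pi) :=
  exists H1 H2 b a,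
    [/\ H = H1 ++ H2, (l, inr b) \in H1 & (l', inl a) \in H2].

(* The sets I_i and R_i of an interval-sequential history are given by
   enumerations. Enumerating the invocations of each block before its responses
   turns the history into a sequence of actions. In a well-formed one a process
   has at most one invocation and one response in a block, so neither the
   projections, nor precedence, nor well-formedness depends on the
   enumerations. *)
Record block (Z : Type) := Block {
  invs : seq (label Pi * A);
  resps : seq (label Pi * U);
  post : Z
}.

Record iseq_history (Z : Type) := ISeqHistory {
  start : Z;
  blocks : seq (block Z)
}.

Definition block_actions Z (B : block Z) : seq (action Pi A U) :=
  [seq (x.1, inl x.2) | x <- invs B] ++ [seq (x.1, inr x.2) | x <- resps B].

Definition actions Z (S : iseq_history Z) : seq (action Pi A U) :=
  flatten [seq block_actions B | B <- blocks S].

Definition interval_linearizable Z (Spec : iseq_history Z -> Prop) H :=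
  exists2 E : seq (action Pi A U),
    [/\ all is_response E, well_formed (H ++ E) & complete (H ++ E)] &
    exists S : iseq_history Z,
      [/\ forall p, proj p (H ++ E) = proj p (actions S),
          Spec S &
          forall l l', precedes H l l' -> precedes (actions S) l l'].
End Histories.

Definition joins d (Z : joinSemilatticeType d) (z : Z) (s : seq Z) : Z :=
  foldr Order.join z s.

Section IntervalSequentialSpecification.
Variables (Pi U : eqType) (d : Order.disp_t) (L : LADT U d).
Implicit Types S : iseq_history Pi (input L) U (state L).

Definition joint_tau (z : state L) (I : seq (label Pi * input L)) : state L :=
  if I is x :: I' then joins (tau z x.2) [seq tau z y.2 | y <- I'] else z.

Fixpoint legal_from S (z : state L) (Bs : seq (block Pi (input L) U (state L))) :
    Prop :=
  if Bs is B :: Bs' then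
    [/\ post B = joint_tau z (invs B),
        forall r, r \in resps B ->
          exists2 a, (r.1, inl a) \in actions S & r.2 = delta (post B) a &
        legal_from S (post B) Bs']
  else True.

Definition iseq_spec S : Prop :=
  [/\ well_formed (actions S), start S = init L &
      legal_from S (start S) (blocks S)].
End IntervalSequentialSpecification.

Section Algorithm.
Variables (Pi U : eqType) (dO dC : Order.disp_t).
Variables (Lo : LADT U dO) (Lc : configLADT Pi U dC).

Let L := ladt_prod Lo Lc.
Let A := input L.
Let Z := state L.

(* Each operation issues one call of RLA.propose, which carries its label. *)
Inductive event :=
  | Invoke of label Pi & A
  | Propose of label Pi & Z
  | Learn of label Pi & Z
  | Return of label Pi & U
  | Crash of Pi
  | Idle.

Inductive phase :=
  | Ready
  | Invoked of label Pi & A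
  | Proposing of label Pi & A
  | Learnt of label Pi & A
  | Crashed.

Record local := Local {
  O_ : state Lo;
  C_ : state Lc;
  phase_ : phase
}.

Definition event_proc (e : event) : option Pi :=
  match e with
  | Invoke l _ | Propose l _ | Learn l _ | Return l _ => Some l.1
  | Crash p => Some p
  | Idle => None
  end.

Inductive local_step : local -> event -> local -> Prop :=
  | StepInvoke O C l a :
      local_step (Local O C Ready) (Invoke l a) (Local O C (Invoked l a))
  | StepProposeO O C l (a : input Lo) :
      local_step (Local O C (Invoked l (inl a))) (Propose l (tau O a, C))
                 (Local O C (Proposing l (inl a)))
  | StepProposeC O C l (a : input Lc) :
      local_step (Local O C (Invoked l (inr a))) (Propose l (O, tau C a))
                 (Local O C (Proposing l (inr a)))
  | StepLearn O C l a O' C' :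
      local_step (Local O C (Proposing l a)) (Learn l (O', C'))
                 (Local O' C' (Learnt l a))
  | StepReturnO O C l (a : input Lo) :
      local_step (Local O C (Learnt l (inl a))) (Return l (delta O a))
                 (Local O C Ready)
  | StepReturnC O C l (a : input Lc) :
      local_step (Local O C (Learnt l (inr a))) (Return l (delta C a))
                 (Local O C Ready)
  | StepCrash O C f p :
      f <> Crashed -> local_step (Local O C f) (Crash p) (Local O C Crashed).

(* A run is infinite; finite executions are padded with Idle, which also stands
   for whatever happens inside the RLA object. *)
Record run := Run {
  ev : nat -> event;
  st : nat -> Pi -> local
}.

Implicit Types x : run.

Definition execution x :=
  [/\ forall p, st x 0 p = Local (init Lo) (init Lc) Ready,
      forall n p,
        if event_proc (ev x n) == Some p
        then local_step (st x n p) (ev x n) (st x n.+1 p)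
        else st x n.+1 p = st x n p &
      forall m n l a a', ev x m = Invoke l a -> ev x n = Invoke l a' -> m = n].

Definition fair x := forall n p,
  match phase_ (st x n p) with
  | Invoked l _ => exists2 m, (n <= m)%N &
      ev x m = Crash p \/ exists v, ev x m = Propose l v
  | Learnt l _ => exists2 m, (n <= m)%N &
      ev x m = Crash p \/ exists b, ev x m = Return l b
  | _ => True
  end.

Definition event_action (e : event) : option (action Pi A U) :=
  match e with
  | Invoke l a => Some (l, inl a)
  | Return l b => Some (l, inr b)
  | _ => None
  end.

Definition history x (n : nat) : seq (action Pi A U) :=
  pmap event_action (mkseq (ev x) n).

Definition correct_client x (p : Pi) :=
  forall n, ev x n = Crash p -> phase_ (st x n p) = Ready.

Definition proposed_config x (n : nat) (C : state Lc) :=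
  exists2 k, (k < n)%N & exists l O, ev x k = Propose l (O, C).

Definition potential x (n : nat) (C : state Lc) :=
  exists2 s : seq (state Lc),
    forall C', C' \in s -> proposed_config x n C' & C = joins (init Lc) s.

Definition superseded x (n : nat) (C : state Lc) :=
  exists2 k, (k < n)%N & exists l O C', ev x k = Learn l (O, C') /\ (C < C')%O.

Definition active x n C := potential x n C /\ ~ superseded x n C.

Definition failed x (n : nat) (p : Pi) := exists2 k, (k < n)%N & ev x k = Crash p.

Definition correct_replica x (p : Pi) :=
  exists n0, forall n, (n0 <= n)%N ->
    (exists2 C, active x n C & members C p) /\ ~ failed x n p.

Definition available x (C : state Lc) :=
  exists2 Q, quorums C Q & Q `<=` correct_replica x.

Definition configuration_availability x := forall C,
  (exists n, potential x n C) -> (forall n, ~ superseded x n C) ->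
  available x C.

Definition finitely_many_configs x :=
  finite_set [set C | exists n, proposed_config x n C].

(* Only values proposed before the response can enter the join. The lower bound
   w <= v' ranges over the values learnt before the invocation of any operation
   contributing to the join, the returning operation l among them. Asking it
   for l alone is too weak for interval-linearizability, already for a max
   register: u proposes 0, y proposes 5 and learns 5, then x proposes 3 and u
   learns 3. *)
Definition validity x := forall n l (v' : Z), ev x n = Learn l v' ->
  exists (v : Z) (D : seq (label Pi * Z)),
    (forall e, e \in (l, v) :: D ->
       exists2 k, (k < n)%N & ev x k = Propose e.1 e.2 /\
         forall j l' (w : Z), (j < k)%N -> ev x j = Learn l' w -> (w <= v')%O) /\
    (v' = joins v [seq e.2 | e <- D] \/
     v' = joins v (init L :: [seq e.2 | e <- D])).

Definition consistency x := forall m n l l' (v v' : Z),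
  ev x m = Learn l v -> ev x n = Learn l' v' -> (v <= v')%O \/ (v' <= v)%O.

Definition reconfigurable_liveness x :=
  configuration_availability x -> finitely_many_configs x ->
  forall n l v, ev x n = Propose l v -> correct_client x l.1 ->
    exists2 m, (n < m)%N & exists v', ev x m = Learn l v'.

Definition RLA x :=
  [/\ validity x, consistency x & reconfigurable_liveness x].
End Algorithm.

Arguments Invoke {Pi U dO dC Lo Lc} _ _.
Arguments Propose {Pi U dO dC Lo Lc} _ _.
Arguments Learn {Pi U dO dC Lo Lc} _ _.
Arguments Return {Pi U dO dC Lo Lc} _ _.
Arguments Crash {Pi U dO dC Lo Lc} _.
Arguments Idle {Pi U dO dC Lo Lc}.

(* Main.v *)
Require Import Defs.
From mathcomp Require Import all_boot all_order.
From mathcomp Require Import boolp.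
From mathcomp Require Import zify.

(** Every reachable state [z] of an L-ADT satisfies [tau z a = z \/ tau z0 a],
    so it is the join of the effects [tau z0 a] of the operations applied so
    far. Order the learn events lexicographically by learnt value, then by time,
    and make each of them a block of the interval-sequential history, followed by
    one last block. An operation is invoked in the first block to whose learnt
    value it contributes and responds in the block of its own learn event;
    pending operations use the last block where either is missing. By validity
    everything learnt before a contributing proposal lies below the learnt value,
    so real-time order is respected, and by induction along the blocks the state
    after each block but the last is exactly the value learnt there. *)

Set Implicit Arguments.
Unset Strict Implicit.
Unset Printing Implicit Defensive.

Import Order.TTheory.

(** * Interval-sequential histories with prescribed blocks *)

(** Since keys strictly increase, the element of key [m], if there is one, comes after all elements
    of smaller key. *)
Lemma filter_keyS (T : eqType) (key : T -> nat) s m :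
  pairwise (relpre key ltn) s ->
  [seq x <- s | key x < m] ++ [seq x <- s | key x == m] =
  [seq x <- s | key x < m.+1].
Proof.
elim: s => //= x s IHs /andP[xs /IHs {}IHs]; rewrite ltnS (leq_eqVlt (key x)).
case: ltngtP => [xm|mx|xm] /=; [by rewrite -IHs | exact: IHs |].
have E : [seq y <- s | key y < m] = [::].
  apply/eqP; rewrite -(negbK (_ == _)) -has_filter -all_predC.
  by apply: sub_all xs => y /= xy; rewrite -leqNgt -xm ltnW.
by rewrite -IHs E.
Qed.

Section Interleaving.
Variables (Pi A U : eqType) (Z : Type).
Variables (idx ridx : label Pi -> nat) (out : label Pi * A -> U) (zs : nat -> Z).
Implicit Types (s : seq (label Pi * A)) (o : label Pi * A).

(* Each operation as an invocation immediately followed by its response: within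
   one process both the completed history and its linearization have this form. *)
Definition sequential s : seq (action Pi A U) :=
  flatten [seq [:: (o.1, inl o.2); (o.1, inr (out o))] | o <- s].

(** Invocations take even and responses odd slots, because a block lists its invocations before its
    responses. *)
Definition slot (y : action Pi A U) : nat :=
  if is_response y then (ridx y.1).*2.+1 else (idx y.1).*2.

Definition slot_block s j : block Pi A U Z :=
  Block [seq o <- s | idx o.1 == j]
        [seq (o.1, out o) | o <- s & ridx o.1 == j] (zs j).

Lemma sequential_cat s1 s2 :
  sequential (s1 ++ s2) = sequential s1 ++ sequential s2.
Proof. by rewrite /sequential map_cat flatten_cat. Qed.

Lemma alternating_sequential s : alternating (sequential s).
Proof. by elim: s => //= [[l a] s IHs] /=; rewrite eqxx. Qed.

Lemma proj_sequential p s :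
  proj p (sequential s) = sequential [seq o <- s | o.1.1 == p].
Proof. by rewrite /proj; elim: s => //= o s ->; case: (_ == p). Qed.

Lemma invocations_sequential s :
  [seq y.1 | y <- sequential s & ~~ is_response y] = [seq o.1 | o <- s].
Proof. by elim: s => //= o s ->. Qed.

Lemma mem_sequential_inl s l a : ((l, inl a) \in sequential s) = ((l, a) \in s).
Proof.
elim: s => // o s IHs; rewrite /= !inE IHs.
by case: o => l' a'; rewrite !xpair_eqE /= andbF orFb.
Qed.

Lemma mem_sequential_inr s l b :
  (l, inr b) \in sequential s -> exists2 o, o \in s & o.1 = l /\ out o = b.
Proof.
elim: s => // o s IHs; rewrite /= !inE => /or3P[|/eqP[-> ->]|/IHs[o' os e]].
- by rewrite xpair_eqE andbF.
- by exists o; rewrite ?inE ?eqxx.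
- by exists o' => //; rewrite inE os orbT.
Qed.

Lemma pairwise_slot s :
  {in s, forall o, idx o.1 <= ridx o.1} ->
  pairwise (fun o o' => ridx o.1 < idx o'.1) s ->
  pairwise (relpre slot ltn) (sequential s).
Proof.
elim: s => //= o s IHs le_s /andP[os /IHs ->]; last first.
  by move=> o' o's; apply: le_s; rewrite inE o's orbT.
have le_o := le_s _ (mem_head _ _).
(* The response slot of the head is bounded first; its invocation slot is smaller still. *)
have H : all (fun y => (ridx o.1).*2.+1 < slot y) (sequential s).
  apply/allP=> -[l [a|b]].
    by rewrite mem_sequential_inl => /(allP os) /=; rewrite /slot ltn_Sdouble.
  move=> /mem_sequential_inr[o' o's [<- _]]; rewrite /slot /= ltnS ltn_double.
  by apply: leq_trans (allP os _ o's) _; apply: le_s; rewrite inE o's orbT.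
rewrite andbT -andbA; apply/and3P; split; last exact: H.
- by rewrite /slot /= ltnS leq_double.
- apply: sub_all H => y /=; apply: leq_trans.
  by rewrite /slot /= !ltnS ltnW // ltnS leq_double.
Qed.

(** Block [j] carries exactly the actions of slots [j.*2] and [j.*2.+1]. As slots strictly increase
    along [sequential s], appending a block extends the filter by two uses of [filter_keyS], one for
    its invocations and one for its responses. *)
Lemma flatten_slot_block s m :
    {in s, forall o, idx o.1 <= ridx o.1} ->
    pairwise (fun o o' => ridx o.1 < idx o'.1) s ->
  flatten [seq block_actions (slot_block s j) | j <- iota 0 m] =
  [seq y <- sequential s | slot y < m.*2].
Proof.
move=> le_s lt_s; have key_s := pairwise_slot le_s lt_s.
have inv_s j : [seq (o.1, inl o.2) | o <- s & idx o.1 == j] =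
    [seq y <- sequential s | slot y == j.*2].
  elim: (s) => //= o s' IHs.
  have -> : (slot (o.1, inl o.2) == j.*2) = (idx o.1 == j) by rewrite /slot /=; lia.
  have -> : (slot (o.1, inr (out o)) == j.*2) = false by rewrite /slot /=; lia.
  by case: eqP => _ /=; rewrite IHs.
have resp_s j : [seq (o.1, inr (out o)) | o <- s & ridx o.1 == j] =
    [seq y <- sequential s | slot y == j.*2.+1].
  elim: (s) => //= o s' IHs.
  have -> : (slot (o.1, inl o.2) == j.*2.+1) = false by rewrite /slot /=; lia.
  have -> : (slot (o.1, inr (out o)) == j.*2.+1) = (ridx o.1 == j)
    by rewrite /slot /=; lia.
  by case: eqP => _ /=; rewrite IHs.
elim: m => [|m IHm]; first by rewrite (eq_filter (a2 := pred0)) ?filter_pred0.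
rewrite -addn1 iotaD map_cat flatten_cat IHm /= cats0 /block_actions /= add0n -map_comp.
by rewrite inv_s resp_s catA !filter_keyS // addn1 doubleS.
Qed.

Lemma proj_slot_block p s j :
  proj p (block_actions (slot_block s j)) =
  block_actions (slot_block [seq o <- s | o.1.1 == p] j).
Proof.
rewrite /proj filter_cat !filter_map -map_comp; congr (_ ++ _).
  by rewrite /= -!filter_predI; congr map; apply: eq_filter => o; rewrite /= andbC.
rewrite /= -map_comp -filter_predI; congr map.
by rewrite -filter_predI; apply: eq_filter => o; rewrite /= andbC.
Qed.

Definition slot_history s n z0 : iseq_history Pi A U Z :=
  ISeqHistory z0 [seq slot_block s j | j <- iota 0 n].

Lemma actions_slot_history s n z0 :
  actions (slot_history s n z0) =
  flatten [seq block_actions (slot_block s j) | j <- iota 0 n].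
Proof. by rewrite /actions /= -map_comp. Qed.

(** Projection commutes with forming blocks, so slots have to increase only among the operations of
    [p]; the bound on [ridx] keeps every slot below [n.*2], so no action is lost. *)
Lemma proj_slot_history p s n z0 :
    {in s, forall o, idx o.1 <= ridx o.1 < n} ->
    pairwise (fun o o' => ridx o.1 < idx o'.1) [seq o <- s | o.1.1 == p] ->
  proj p (actions (slot_history s n z0)) =
  sequential [seq o <- s | o.1.1 == p].
Proof.
move=> le_s lt_s; rewrite actions_slot_history /proj filter_flatten -map_comp.
rewrite (eq_map (proj_slot_block p s)) flatten_slot_block //; last first.
  by move=> o; rewrite mem_filter => /andP[_ /le_s/andP[]].
apply/all_filterP/allP=> -[l [a|b]].
  rewrite mem_sequential_inl mem_filter => /andP[_ /le_s/andP[lo hi]].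
  by rewrite /slot ltn_double (leq_ltn_trans lo hi).
move=> /mem_sequential_inr[o]; rewrite mem_filter => /andP[_ /le_s/andP[_ hi]].
by case=> <- _; rewrite /slot /= ltn_Sdouble.
Qed.

Lemma precedes_slot_history s n z0 o o' :
    o \in s -> o' \in s -> ridx o.1 < idx o'.1 < n ->
  precedes (actions (slot_history s n z0)) o.1 o'.1.
Proof.
move=> os o's /andP[lt_oo' lt_n]; rewrite actions_slot_history.
(* The history is cut right after the block in which [o] responds. *)
have -> : n = (ridx o.1).+1 + (n - (ridx o.1).+1) by lia.
rewrite iotaD map_cat flatten_cat.
exists (flatten [seq block_actions (slot_block s j) | j <- iota 0 (ridx o.1).+1]).
eexists; exists (out o), o'.2; split; first by [].
- apply/flatten_mapP; exists (ridx o.1); first by rewrite mem_iota /=; lia.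
  rewrite mem_cat; apply/orP; right; apply/mapP; exists (o.1, out o) => //.
  by apply/mapP; exists o => //; rewrite mem_filter eqxx.
- apply/flatten_mapP; exists (idx o'.1); first by rewrite mem_iota; lia.
  rewrite mem_cat; apply/orP; left; apply/mapP; exists o' => //=.
  by rewrite mem_filter eqxx.
Qed.
End Interleaving.

(** * Joins and reachable states of an L-ADT *)

Lemma joins_lub d (Z : joinSemilatticeType d) (z u : Z) s :
  (joins z s <= u)%O = (z <= u)%O && all (fun y => y <= u)%O s.
Proof. by elim: s => [|y s IHs] /=; rewrite ?andbT // leUx IHs andbCA. Qed.

(** Through upper bounds, identities between iterated joins become equivalences of conjunctions of
    inequalities. *)
Lemma eq_le_upper d (Z : porderType d) (x y : Z) :
  (forall u, (x <= u)%O = (y <= u)%O) -> x = y.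
Proof. by move=> e; apply: le_anti; rewrite e lexx -e lexx. Qed.

Section ReachableStates.
Variables (U : eqType) (d : Order.disp_t) (L : LADT U d).
Implicit Types (z : state L) (a : input L).

Inductive reachable : state L -> Prop :=
  | ReachableInit : reachable (init L)
  | ReachableTau z a : reachable z -> reachable (tau z a).

Lemma reachable_ge z : reachable z -> (init L <= z)%O.
Proof. by elim=> // {}z a _ /le_trans; apply; apply: tau_ge. Qed.

(* At unreachable states the L-ADT laws do not force this identity. *)
Lemma tau_reachable z a : reachable z -> tau z a = Order.join z (tau (init L) a).
Proof.
elim=> [|{}z b _ IHz]; first by rewrite join_r ?tau_ge.
by rewrite tau_join IHz joinA (join_l (tau_ge _ _)).
Qed.

(** Replaying on top of [z] the inputs that lead from the initial state to [z'] leads to the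
    join. *)
Lemma reachable_join z z' :
  reachable z -> reachable z' -> reachable (Order.join z z').
Proof.
move=> rz; elim=> [|{}z' a rz' IHz']; first by rewrite join_l ?reachable_ge.
rewrite (tau_reachable a rz') joinA -(tau_reachable a IHz').
exact: ReachableTau.
Qed.

Lemma reachable_joins z s :
  reachable z -> (forall y, y \in s -> reachable y) -> reachable (joins z s).
Proof.
move=> rz; elim: s => //= y s IHs rs; apply: reachable_join.
  by apply: rs; rewrite mem_head.
by apply: IHs => y' y's; apply: rs; rewrite inE y's orbT.
Qed.

(** At a reachable state each [tau z a] splits into [z] and the effect of [a] on the initial state.
    This also absorbs the separate case of an empty block. *)
Lemma joint_tau_reachable (Pi : eqType) z (I : seq (label Pi * input L)) :
  reachable z -> joint_tau z I = joins z [seq tau (init L) y.2 | y <- I].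
Proof.
move=> rz; case: I => //= y I; apply: eq_le_upper => u.
rewrite joins_lub leUx joins_lub tau_reachable // leUx.
case: (boolP (z <= u)%O) => [zu|]; rewrite ?andbF //=; congr (_ && _).
rewrite !all_map.
by apply: eq_all => y' /=; rewrite tau_reachable // leUx zu.
Qed.
End ReachableStates.

(** * Histories with equal projections *)

Section Projections.
Variables Pi A U : eqType.
Implicit Types H G : seq (action Pi A U).

Lemma proj_cat p H G : proj p (H ++ G) = proj p H ++ proj p G.
Proof. exact: filter_cat. Qed.

Lemma mem_proj H y : (y \in proj y.1.1 H) = (y \in H).
Proof. by rewrite mem_filter eqxx. Qed.

(** All occurrences of an action lie in the projection on its own process, so multiplicities can be
    counted there. *)
Lemma perm_proj H G : (forall p, proj p H = proj p G) -> perm_eq H G.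
Proof.
move=> eqHG; apply/allP=> y _; apply/eqP.
have count_proj K : count_mem y K = count_mem y (proj y.1.1 K).
  rewrite count_filter; apply: eq_count => y' /=.
  by case: eqP => //= ->; rewrite eqxx.
by rewrite count_proj eqHG -count_proj.
Qed.

Lemma well_formed_proj H G :
  (forall p, proj p H = proj p G) -> well_formed G -> well_formed H.
Proof.
move=> eqHG [uniqG altG]; split=> [|p]; last by rewrite eqHG.
by rewrite (perm_uniq (perm_map _ (perm_filter _ (perm_proj eqHG)))).
Qed.

Lemma well_formed_sequential (out : label Pi * A -> U) s :
  uniq [seq o.1 | o <- s] -> well_formed (sequential out s).
Proof.
move=> us; split=> [|p]; first by rewrite invocations_sequential.
by rewrite proj_sequential alternating_sequential.
Qed.
End Projections.

(** * A criterion for interval-linearizability *)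

Section Linearization.
Variables (Pi U : eqType) (d : Order.disp_t) (L : LADT U d).
Variables (ops : seq (label Pi * input L)) (idx ridx : label Pi -> nat) (n : nat).

(** The state before block [j], by [cumulativeS]. *)
Definition cumulative (j : nat) : state L :=
  joins (init L) [seq tau (init L) o.2 | o <- ops & idx o.1 < j].

(** A response reads the state after its own block, hence the successor. *)
Definition outcome (o : label Pi * input L) : U :=
  delta (cumulative (ridx o.1).+1) o.2.

Let S := slot_history idx ridx outcome (fun j => cumulative j.+1) ops n (init L).

Lemma reachable_cumulative j : reachable (cumulative j).
Proof.
apply: reachable_joins => [|y /mapP[o _ ->]]; first exact: ReachableInit.
by apply: ReachableTau; exact: ReachableInit.
Qed.

Lemma cumulativeS j :
  cumulative j.+1 = joint_tau (cumulative j) [seq o <- ops | idx o.1 == j].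
Proof.
rewrite joint_tau_reachable; last exact: reachable_cumulative.
apply: eq_le_upper => u; rewrite !joins_lub -andbA; congr (_ && _).
elim: ops => //= o s IHs; rewrite ltnS leq_eqVlt.
by case: ltngtP => /= _; rewrite IHs //; [rewrite andbA | rewrite andbCA]. 
Qed.

Lemma iseq_spec_slot_history :
    {in ops, forall o, idx o.1 <= ridx o.1 < n} -> well_formed (actions S) ->
  iseq_spec S.
Proof.
move=> le_ops wfS.
(* The first block [m] is generalized so that the induction on the number of blocks can advance
   it. *)
suff legalS k m : legal_from S (cumulative m)
    [seq slot_block idx ridx outcome (fun j => cumulative j.+1) ops j
       | j <- iota m k].
  split=> //=; have {1}-> : init L = cumulative 0; last exact: legalS.
  by rewrite /cumulative filter_pred0.
elim: k m => //= k IHk m; split; [exact: cumulativeS | | exact: IHk].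
move=> r /mapP[o]; rewrite mem_filter => /andP[/eqP rm oops] ->.
exists o.2; last by rewrite /outcome rm.
rewrite actions_slot_history; apply/flatten_mapP; exists (idx o.1).
  by rewrite mem_iota; have /andP[] := le_ops _ oops; exact: leq_ltn_trans.
rewrite mem_cat; apply/orP; left; apply/mapP; exists o => //.
by rewrite mem_filter eqxx.
Qed.

(** For each process, [q] lists the completed operations and [w] the pending one, if any. Once the
    pending operations are answered, the history and the slot history both project to the sequential
    form of the operations of the process. *)
Lemma interval_linearizable_slots (H : seq (action Pi (input L) U)) :
    uniq [seq o.1 | o <- ops] ->
    (forall p, exists q w,
      proj p H = sequential outcome q ++
                 [seq (o.1, inl o.2) | o <- seq_of_opt w] /\
      [seq o <- ops | o.1.1 == p] = q ++ seq_of_opt w) ->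
    {in ops, forall o, idx o.1 <= ridx o.1 < n} ->
    (forall p, pairwise (fun o o' => ridx o.1 < idx o'.1)
                        [seq o <- ops | o.1.1 == p]) ->
    (forall l l', precedes H l l' -> ridx l < idx l') ->
  interval_linearizable (@iseq_spec Pi U d L) H.
Proof.
move=> u_ops projH le_ops lt_ops prec_ops.
pose responded := [seq y.1 | y <- H & is_response y].
pose out_action o : action Pi (input L) U := (o.1, inr (outcome o)).
(* Pending operations are answered with the output that their response block prescribes. *)
pose E := [seq out_action o | o <- ops & o.1 \notin responded].
have projHE p : proj p (H ++ E) = proj p (sequential outcome ops).
  have [q [w [projHp opsp]]] := projH p.
  have procP o : o \in q ++ seq_of_opt w -> o.1.1 = p.
    by rewrite -opsp mem_filter => /andP[/eqP].
  have u_opsp : uniq [seq o.1 | o <- q ++ seq_of_opt w].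
    by rewrite -opsp (subseq_uniq _ u_ops) // map_subseq // filter_subseq.
  have respP o : o \in q ++ seq_of_opt w ->
      (o.1 \in responded) = (o.1 \in [seq o.1 | o <- q]).
    move=> /procP op; apply/mapP/mapP.
      case=> -[l [a|b]]; rewrite mem_filter //= -mem_proj => lH lo.
      move: lH; rewrite /= -lo op projHp mem_cat => /orP[|/mapP[? _ //]].
      by move=> /mem_sequential_inr[o' o'q [o'o _]]; exists o'; rewrite // o'o.
    case=> o' o'q eq_oo'; exists (out_action o') => //.
    rewrite mem_filter -mem_proj /= -eq_oo' op projHp mem_cat; apply/orP; left.
    by apply/flatten_mapP; exists o' => //; rewrite !inE eqxx orbT.
  rewrite proj_cat proj_sequential opsp projHp sequential_cat -catA.
  congr (_ ++ _); rewrite /E /proj filter_map.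
  rewrite -filter_predI (eq_filter (a2 := predI (fun o => o.1 \notin responded)
    (fun o => o.1.1 == p))); last by move=> o /=; rewrite andbC.
  rewrite filter_predI opsp filter_cat.
  have -> : [seq o <- q | o.1 \notin responded] = [::].
    apply/eqP; rewrite -(negbK (_ == _)) -has_filter -all_predC.
    apply/allP => o oq /=; rewrite negbK respP ?map_f //.
    by rewrite mem_cat oq.
  have -> : [seq o <- seq_of_opt w | o.1 \notin responded] = seq_of_opt w.
    apply/all_filterP/allP => o ow; rewrite respP ?mem_cat ?ow ?orbT //.
    move: u_opsp; rewrite map_cat cat_uniq => /and3P[_ /hasPn h _].
    by apply: h; rewrite map_f.
  by case: (w) => [o|].
have projS p : proj p (actions S) = proj p (sequential outcome ops).
  by rewrite proj_slot_history // proj_sequential.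
have wf_ops := well_formed_sequential outcome u_ops.
have wfS := well_formed_proj projS wf_ops.
exists E.
  split; first by rewrite all_map; apply/allP.
    exact: well_formed_proj wf_ops.
  have memE := perm_mem (perm_proj projHE).
  move=> l a; rewrite memE mem_sequential_inl => laops.
  exists (outcome (l, a)); rewrite memE.
  by apply/flatten_mapP; exists (l, a) => //; rewrite !inE eqxx orbT.
exists S; split.
- by move=> p; rewrite projHE projS.
- exact: iseq_spec_slot_history.
(* Precedence speaks of labels; this recovers the operations behind the labels in [H]. *)
have memH l y : (l, y) \in H -> exists2 o, o \in ops & o.1 = l.
  have [q [w [projHp opsp]]] := projH l.1.
  have sub_ops : {subset q ++ seq_of_opt w <= ops}.
    by move=> o; rewrite -opsp mem_filter => /andP[].
  rewrite -mem_proj projHp mem_cat => /orP[|/mapP[o ow [-> _]]].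
    case: y => [a|b].
      rewrite mem_sequential_inl => laq; exists (l, a) => //.
      by apply: sub_ops; rewrite mem_cat laq.
    move=> /mem_sequential_inr[o oq [<- _]]; exists o => //.
    by apply: sub_ops; rewrite mem_cat oq.
  by exists o => //; apply: sub_ops; rewrite mem_cat ow orbT.
move=> l l' prec_ll'; have lt_ll' := prec_ops _ _ prec_ll'.
have [H1 [H2 [b [a [eqH lH1 l'H2]]]]] := prec_ll'.
have [o oops ol] : exists2 o, o \in ops & o.1 = l.
  by apply: (memH l (inr b)); rewrite eqH mem_cat lH1.
have [o' o'ops o'l] : exists2 o, o \in ops & o.1 = l'.
  by apply: (memH l' (inl a)); rewrite eqH mem_cat l'H2 orbT.
rewrite -ol -o'l; apply: precedes_slot_history => //; rewrite ol o'l lt_ll' /=.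
by have /andP[] := le_ops _ o'ops; rewrite o'l; apply: leq_ltn_trans.
Qed.
End Linearization.

(** * Invariants of the runs of the algorithm *)

Section Runs.
Variables (Pi U : eqType) (dO dC : Order.disp_t).
Variables (Lo : LADT U dO) (Lc : configLADT Pi U dC) (x : run Lo Lc).
Hypothesis exec : execution x.

Let L := ladt_prod Lo Lc.

(** The possible contents of the variables [O_] and [C_] of a process; which operation learnt the
    value is immaterial. *)
Definition init_or_learnt n (z : state L) :=
  z = init L \/ exists2 j, j < n & exists l, ev x j = Learn l z.

Definition invoked_before n l (a : input L) :=
  exists2 i, i < n & ev x i = Invoke l a.

Definition learnt_before n l := exists2 j, j < n & exists v, ev x j = Learn l v.

Definition local_invariant n p :=
  let: Local zO zC f := st x n p in
  init_or_learnt n (zO, zC) /\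
  match f with
  | Invoked l a | Proposing l a => l.1 = p /\ invoked_before n l a
  | Learnt l a =>
      [/\ l.1 = p, invoked_before n l a &
          exists2 j, j < n & ev x j = Learn l (zO, zC)]
  | _ => True
  end.

Lemma st_next n p :
  event_proc (ev x n) != Some p -> st x n.+1 p = st x n p.
Proof. by case: exec => [_ /(_ n p) + _]; case: eqP. Qed.

Lemma step_event n p :
  event_proc (ev x n) = Some p -> local_step (st x n p) (ev x n) (st x n.+1 p).
Proof. by case: exec => [_ /(_ n p) + _]; case: eqP. Qed.

Lemma invoke_uniq m n l a a' :
  ev x m = Invoke l a -> ev x n = Invoke l a' -> m = n /\ a = a'.
Proof.
have [_ _ u] := exec => em en; have mn := u _ _ _ _ _ em en; split=> //.
by move: em; rewrite mn en => -[].
Qed.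

Lemma init_or_learntS n z : init_or_learnt n z -> init_or_learnt n.+1 z.
Proof. by case=> [|[j jn e]]; [left | right; exists j; rewrite // ltnW]. Qed.

Lemma invoked_beforeS n l a : invoked_before n l a -> invoked_before n.+1 l a.
Proof. by case=> i ni e; exists i; rewrite // ltnW. Qed.

Lemma local_invariantP n p : local_invariant n p.
Proof.
rewrite /local_invariant; elim: n => [|n IHn].
  by have [-> _ _] := exec; split; [left|].
have := @step_event n p; have := @st_next n p.
case: eqP => [ep _ /(_ ep)|_ /(_ isT) -> _]; last first.
  case: (st x n p) IHn => zO zC f [/init_or_learntS z IHf]; split=> //.
  case: f IHf => // l a; rewrite /invoked_before.
  - by case=> lp /invoked_beforeS.
  - by case=> lp /invoked_beforeS.
  - by case=> lp /invoked_beforeS i [j jn e]; split=> //; exists j; rewrite // ltnW.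
move eqe: {1}(ev x n) => e step; case: step eqe IHn.
- move=> zO zC l a e' [/init_or_learntS zP _]; split=> //; split.
    by move: ep; rewrite e' => -[].
  by exists n.
- by move=> zO zC l a _ [/init_or_learntS zP [lp /invoked_beforeS]].
- by move=> zO zC l a _ [/init_or_learntS zP [lp /invoked_beforeS]].
- move=> zO zC l a zO' zC' e' [_ [lp /invoked_beforeS]]; split.
    by right; exists n => //; exists l.
  by split=> //; exists n.
- by move=> zO zC l a _ [/init_or_learntS].
- by move=> zO zC l a _ [/init_or_learntS].
- by move=> zO zC f q _ _ [/init_or_learntS].
Qed.

Lemma propose_inv k l v : ev x k = Propose l v ->
  exists z a, [/\ invoked_before k l a, init_or_learnt k z & v = prod_tau z a].
Proof.
move=> ek; have ep : event_proc (ev x k) = Some l.1 by rewrite ek.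
have := local_invariantP k l.1; have := step_event ep; rewrite /local_invariant ek.
move eqe: (Propose l v) => e step; case: step eqe => //.
  by move=> zO zC l' a [-> ->] [zP [_ ia]]; exists (zO, zC), (inl a).
by move=> zO zC l' a [-> ->] [zP [_ ia]]; exists (zO, zC), (inr a).
Qed.

Lemma learn_inv j l v : ev x j = Learn l v -> exists a, invoked_before j l a.
Proof.
move=> ej; have ep : event_proc (ev x j) = Some l.1 by rewrite ej.
have := local_invariantP j l.1; have := step_event ep; rewrite /local_invariant ej.
move eqe: (Learn l v) => e step; case: step eqe => //.
by move=> zO zC l' a zO' zC' [-> _] [_ [_ ia]]; exists a.
Qed.

Lemma return_inv r l b : ev x r = Return l b -> exists a v j,
  [/\ invoked_before r l a, j < r, ev x j = Learn l v & b = prod_delta v a].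
Proof.
move=> er; have ep : event_proc (ev x r) = Some l.1 by rewrite er.
have := local_invariantP r l.1; have := step_event ep; rewrite /local_invariant er.
move eqe: (Return l b) => e step; case: step eqe => //.
  by move=> zO zC l' a [-> ->] [_ [_ ia [j jr ej]]]; exists (inl a), (zO, zC), j.
by move=> zO zC l' a [-> ->] [_ [_ ia [j jr ej]]]; exists (inr a), (zO, zC), j.
Qed.

(** A [Learn] with the label before its invocation would presuppose a still earlier invocation, but
    a label is invoked only once. *)
Lemma not_learnt_before n p :
  match phase_ (st x n p) with
  | Invoked l _ | Proposing l _ => ~ learnt_before n l
  | _ => True
  end.
Proof.
elim: n => [|n IHn]; first by have [-> _ _] := exec.
have := @step_event n p; have := @st_next n p.
case: eqP => [ep _ /(_ ep)|ep /(_ isT) -> _]; last first.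
  have := local_invariantP n p; rewrite /local_invariant.
  have keep l : l.1 = p -> ~ learnt_before n l -> ~ learnt_before n.+1 l.
    move=> lp h [j + [v ej]]; rewrite ltnS leq_eqVlt => /predU1P[jn|jn].
      by apply: ep; rewrite -jn ej /= lp.
    by apply: h; exists j => //; exists v.
  by case: (st x n p) IHn => zO zC [|l a|l a|l a|] //= nl [_ [lp _]]; apply: keep.
move eqe: {1}(ev x n) => e step; case: step eqe IHn => //=.
- move=> _ _ l a e' _ [j + [v ej]]; rewrite ltnS leq_eqVlt => /predU1P[jn|jn].
    by move: ej; rewrite jn e'.
  have [a' [i ij ei]] := learn_inv ej; have [] := invoke_uniq e' ei.
  by move=> ni; move: ij; rewrite -ni ltnNge ltnW.
- move=> zO zC l a e' nl [j + [v ej]]; rewrite ltnS leq_eqVlt => /predU1P[jn|jn].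
    by move: ej; rewrite jn e'.
  by apply: nl; exists j => //; exists v.
- move=> zO zC l a e' nl [j + [v ej]]; rewrite ltnS leq_eqVlt => /predU1P[jn|jn].
    by move: ej; rewrite jn e'.
  by apply: nl; exists j => //; exists v.
Qed.

Lemma learn_once m n l v v' : m < n ->
  ev x m = Learn l v -> ev x n = Learn l v' -> False.
Proof.
move=> mn em en; have ep : event_proc (ev x n) = Some l.1 by rewrite en.
have := not_learnt_before n l.1; have := step_event ep; rewrite en.
move eqe: (Learn l v') => e step; case: step eqe => //.
by move=> zO zC l' a zO' zC' [<- _] /=; apply; exists m => //; exists v.
Qed.

Lemma learn_uniq m n l v v' :
  ev x m = Learn l v -> ev x n = Learn l v' -> m = n.
Proof.
move=> em en; case: (ltngtP m n) => // mn.
  by case: (learn_once mn em en).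
by case: (learn_once mn en em).
Qed.

(** * Operations and history of a run *)

Definition operations n : seq (label Pi * input L) :=
  pmap (fun e => if e is Invoke l a then Some (l, a) else None)
       (mkseq (ev x) n).

Lemma historyS n :
  history x n.+1 = history x n ++ seq_of_opt (event_action (ev x n)).
Proof. by rewrite /history mkseqS -cats1 pmap_cat /=; case: event_action. Qed.

Lemma operationsS n : operations n.+1 = operations n ++
  seq_of_opt (if ev x n is Invoke l a then Some (l, a) else None).
Proof. by rewrite /operations mkseqS -cats1 pmap_cat /=; case: (ev x n). Qed.

Lemma mem_history n y :
  y \in history x n -> exists2 i, i < n & event_action (ev x i) = Some y.
Proof.
elim: n => // n IHn; rewrite historyS mem_cat => /orP[/IHn[i ni ei]|].
  by exists i; rewrite // ltnW.
by case ei: event_action => [y'|] //=; rewrite inE => /eqP->; exists n.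
Qed.

Lemma mem_operations n l a : (l, a) \in operations n <-> invoked_before n l a.
Proof.
elim: n => [|n IHn]; first by split=> // -[].
rewrite operationsS mem_cat; split.
  case/orP => [/IHn|]; first exact: invoked_beforeS.
  by case en: (ev x n) => [l' a'|||||] //=; rewrite inE => /eqP[-> ->]; exists n.
case=> i; rewrite ltnS leq_eqVlt => /predU1P[->|ni] ei; apply/orP; [right|left].
  by rewrite ei /= mem_head.
by apply/IHn; exists i.
Qed.

Lemma uniq_operations n : uniq [seq o.1 | o <- operations n].
Proof.
elim: n => // n IHn; rewrite operationsS map_cat cat_uniq IHn /=.
case en: (ev x n) => [l a|||||] //=; rewrite orbF andbT.
apply/mapP => -[[l' a'] /mem_operations[i ni ei] /= ll'].
by move: ei ni; rewrite -ll' => ei; have [-> _] := invoke_uniq en ei; rewrite ltnn.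
Qed.

Definition current (f : phase Lo Lc) :=
  match f with
  | Invoked l a | Proposing l a | Learnt l a => Some (l, a)
  | _ => None
  end.

(** Provides the shape that [interval_linearizable_slots] asks for. The last two conjuncts
    strengthen the induction: [w] is read off the phase until a crash freezes it, and the operations
    in [q] have returned. *)
Lemma proj_history n (out : label Pi * input L -> U) (lt : rel (label Pi)) p :
    (forall r l b a, r < n ->
       ev x r = Return l b -> invoked_before r l a -> out (l, a) = b) ->
    (forall r l b i l' a, r < i < n ->
       ev x r = Return l b -> ev x i = Invoke l' a -> lt l l') ->
  pairwise (fun o o' => lt o.1 o'.1) [seq o <- operations n | o.1.1 == p] /\
  exists q w, [/\
    proj p (history x n) =
      sequential out q ++ [seq (o.1, inl o.2) | o <- seq_of_opt w],
    [seq o <- operations n | o.1.1 == p] = q ++ seq_of_opt w,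
    phase_ (st x n p) <> Crashed Lo Lc -> w = current (phase_ (st x n p)) &
    forall o, o \in q -> exists2 r, r < n & exists b, ev x r = Return o.1 b].
Proof.
elim: n => [|n IHn] outP ltP.
  by split=> //; exists [::], None; have [-> _ _] := exec.
have [||pw [q [w [projp opsp wP qP]]]] := IHn.
- by move=> r l b a rn; apply: outP; rewrite ltnW.
- by move=> r l b i l' a /andP[ri iN]; apply: ltP; rewrite ri ltnW.
have qPS o : o \in q ->
    exists2 r, r < n.+1 & exists b, ev x r = Return o.1 b.
  by move=> /qP[r rn e]; exists r; rewrite // ltnW.
rewrite historyS operationsS proj_cat filter_cat.
have := local_invariantP n p; rewrite /local_invariant.
have := @step_event n p; have := @st_next n p.
case: eqP => [ep _ /(_ ep)|ep /(_ isT) -> _ _]; last first.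
  have -> : proj p (seq_of_opt (event_action (ev x n))) = [::].
    by case: (ev x n) ep => //= l ? lp; case: eqP => // ll; case: lp; rewrite ll.
  set N := seq_of_opt _; have -> : [seq o <- N | o.1.1 == p] = [::].
    rewrite /N; case: (ev x n) ep => //= l ? lp; case: eqP => // ll.
    by case: lp; rewrite ll.
  by rewrite !cats0; split=> //; exists q, w.
move eqe: {1}(ev x n) => e step; case: step eqe projp opsp wP pw => /=.
- move=> zO zC l a e' projp opsp wP pw _; rewrite e' /=.
  have lp : l.1 = p by move: ep; rewrite e' => -[].
  (* An invoking process is in phase [Ready], so [w] is empty and all its earlier operations have
     returned, as [ltP] requires. *)
  rewrite lp eqxx; move: opsp projp; rewrite wP //= !cats0 => opsp projp.
  split; last by exists q, (Some (l, a)); rewrite opsp projp.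
  rewrite opsp in pw *; rewrite pairwise_cat pw /= !andbT allrel1r.
  apply/allP => o /qP[r rn [b er]]; apply: (ltP r o.1 b n l a) => //.
  by rewrite rn /=.
- move=> zO zC l a e' projp opsp wP pw _; rewrite e' /= !cats0; split=> //.
  by exists q, w; split=> // _; apply: wP.
- move=> zO zC l a e' projp opsp wP pw _; rewrite e' /= !cats0; split=> //.
  by exists q, w; split=> // _; apply: wP.
- move=> zO zC l a zO' zC' e' projp opsp wP pw _; rewrite e' /= !cats0; split=> //.
  by exists q, w; split=> // _; apply: wP.
- move=> zO zC l a e' projp opsp wP pw [_ [lp ia _]]; rewrite e' /= lp eqxx.
  rewrite !cats0; split=> //.
  (* The pending operation passes from [w] to [q], and [outP] identifies its output. *)
  exists (rcons q (l, inl a)), None; rewrite -cats1 sequential_cat projp opsp.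
  rewrite wP //=; split=> //.
  + rewrite cats0 -catA /= /sequential /= (outP n l _ (inl a) _ e') //.
  + by rewrite cats0.
  + move=> o; rewrite mem_cat mem_seq1 => /orP[/qPS//|/eqP->].
    by exists n => //; exists (delta zO a).
- move=> zO zC l a e' projp opsp wP pw [_ [lp ia _]]; rewrite e' /= lp eqxx.
  rewrite !cats0; split=> //.
  exists (rcons q (l, inr a)), None; rewrite -cats1 sequential_cat projp opsp.
  rewrite wP //=; split=> //.
  + rewrite cats0 -catA /= /sequential /= (outP n l _ (inr a) _ e') //.
  + by rewrite cats0.
  + move=> o; rewrite mem_cat mem_seq1 => /orP[/qPS//|/eqP->].
    by exists n => //; exists (delta zC a).
- move=> zO zC f p' _ e' projp opsp wP pw _; rewrite e' /= !cats0; split=> //.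
  by exists q, w.
Qed.
End Runs.

(** * Contributions to learnt values and the order of learn events *)

Section LearntOrder.
Variables (Pi U : eqType) (dO dC : Order.disp_t).
Variables (Lo : LADT U dO) (Lc : configLADT Pi U dC) (x : run Lo Lc).
Hypotheses (exec : execution x) (valid : validity x) (consistent : consistency x).

Let L := ladt_prod Lo Lc.

(** Strong induction on time: by validity the value is a join of proposals, each one transition away
    from the initial state or from a value learnt earlier. *)
Lemma reachable_learnt t l v : ev x t = Learn l v -> reachable (v : state L).
Proof.
elim/ltn_ind: t l v => t IHt l v /valid[v0 [D [DP vE]]].
have rP (e : label Pi * state L) : e \in (l, v0) :: D -> reachable e.2.
  move=> /DP[k kt [/(propose_inv exec)[z [a [_ zP ->]]] _]].
  apply: ReachableTau; case: zP => [->|[j jk [l' /IHt]]]; first exact: ReachableInit.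
  by apply; exact: ltn_trans kt.
have rD y : y \in [seq e.2 | e <- D] -> reachable y.
  by case/mapP => e eD ->; apply: rP; rewrite inE eD orbT.
have rv0 := rP _ (mem_head _ _).
case: vE => ->; apply: reachable_joins => // y; rewrite inE => /orP[/eqP->|/rD //].
exact: ReachableInit.
Qed.

Definition learnt_bound k (z : state L) :=
  forall j l w, j < k -> ev x j = Learn l w -> (w <= z)%O.

(** The labels of the proposals joined into the value learnt at time [t]. The join is recorded by
    its universal property, tested on upper bounds of [init L] only, which covers both forms of the
    join in [validity]. *)
Definition contributors t (ls : seq (label Pi)) := forall l v, ev x t = Learn l v ->
  [/\ l \in ls,
      forall l', l' \in ls -> exists k v', [/\ k < t, ev x k = Propose l' v',
        (v' <= v)%O & learnt_bound k v] &
      forall u, (init L <= u)%O ->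
        (forall l' k v', l' \in ls -> k < t -> ev x k = Propose l' v' ->
           learnt_bound k v -> (v' <= u)%O) -> (v <= u)%O].

Lemma contributors_exist t : exists ls, contributors t ls.
Proof.
have [[l [v et]]|nt] := pselect (exists l v, ev x t = Learn l v); last first.
  by exists [::] => l v et; case: nt; exists l, v.
have [v0 [D [DP vE]]] := valid et.
have vub (u : state L) : (init L <= u)%O ->
    (v <= u)%O = (v0 <= u)%O && all (fun y => y <= u)%O [seq e.2 | e <- D].
  by move=> iu; case: vE => ->; rewrite joins_lub //= iu.
exists [seq e.1 | e <- (l, v0) :: D] => l' v'; rewrite et => -[<- <-]; split.
- exact: mem_head.
- move=> {}l' /mapP[e eD ->]; have [k kt [ek bk]] := DP _ eD.
  exists k, e.2; split=> //.
  (* Taking [v] itself as the upper bound puts every contributing proposal below it. *)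
  have /vub := reachable_ge (reachable_learnt et); rewrite lexx.
  case/esym/andP => v0v /allP Dv; move: eD; rewrite inE => /predU1P[->//|eD].
  by apply: Dv; rewrite map_f.
- move=> u iu uP; rewrite vub //.
  have eP e : e \in (l, v0) :: D -> (e.2 <= u)%O.
    by move=> eD; have [k kt [ek bk]] := DP _ eD; apply: uP ek bk; rewrite // map_f.
  rewrite (eP _ (mem_head _ _)) /=; apply/allP => _ /mapP[e eD ->].
  by apply: eP; rewrite inE eD orbT.
Qed.

Definition learner t : option (label Pi) :=
  if ev x t is Learn l _ then Some l else None.

Definition learnt_value t : state L := if ev x t is Learn _ v then v else init L.

Definition learnt_le t t' :=
  (learnt_value t < learnt_value t')%O ||
  (learnt_value t == learnt_value t') && (t <= t').

Definition learn_times n := sort learnt_le [seq t <- iota 0 n | learner t].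

Lemma learnerP t l : learner t = Some l <-> ev x t = Learn l (learnt_value t).
Proof.
rewrite /learner /learnt_value; case: (ev x t) => [? ?|? ?|l' v|? ?|?|]; split=> //.
  by case=> ->.
by case=> ->.
Qed.

Lemma mem_learn_times n t : (t \in learn_times n) = (t < n) && learner t.
Proof. by rewrite mem_sort mem_filter mem_iota andbC. Qed.

Lemma uniq_learn_times n : uniq (learn_times n).
Proof. by rewrite sort_uniq filter_uniq ?iota_uniq. Qed.

Lemma learnt_le_value t t' : learnt_le t t' -> (learnt_value t <= learnt_value t')%O.
Proof. by case/orP => [/ltW//|/andP[/eqP-> _]]. Qed.

Lemma learnt_le_refl : reflexive learnt_le.
Proof. by move=> t; rewrite /learnt_le eqxx leqnn orbT. Qed.

Lemma learnt_le_trans : transitive learnt_le.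
Proof.
move=> t t' t'' /orP[h|/andP[/eqP e h]] /orP[h'|/andP[/eqP e' h']]; rewrite /learnt_le.
- by rewrite (lt_trans h h').
- by rewrite -e' h.
- by rewrite e h'.
- by rewrite e e' eqxx (leq_trans h h') orbT.
Qed.

(** Totality of [learnt_le] is available at learn events, where consistency compares the values and
    time decides ties; hence the relativized sorting lemma. *)
Lemma sorted_learn_times n : sorted learnt_le (learn_times n).
Proof.
apply: (@sort_sorted_in _ (fun t => learner t)); last first.
  exact: filter_all.
move=> i j; rewrite !unfold_in; case ei: (learner i) => [li|] // _.
case ej: (learner j) => [lj|] // _; move/learnerP: ei => ei; move/learnerP: ej => ej.
rewrite /learnt_le (eq_sym (learnt_value j)).
case: (consistent ei ej); rewrite le_eqVlt => /predU1P[->|->]; rewrite ?orbT //.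
  by rewrite ltxx eqxx leq_total.
by rewrite ltxx eqxx leq_total.
Qed.

(** Ties are broken by time, so the index grows strictly even when the two values agree. *)
Lemma index_learn_times n t t' : t \in learn_times n -> t' \in learn_times n ->
  (learnt_value t <= learnt_value t')%O -> t < t' ->
  index t (learn_times n) < index t' (learn_times n).
Proof.
move=> tn t'n le_v lt_t; rewrite ltnNge; apply/negP => le_i.
suff /orP[lt_v|/andP[_]] : learnt_le t' t.
- by have := lt_le_trans lt_v le_v; rewrite ltxx.
- by rewrite leqNgt lt_t.
apply: (sorted_leq_index learnt_le_trans learnt_le_refl) le_i => //.
exact: sorted_learn_times.
Qed.

(** * Placement of the operations in blocks *)

Section Placement.
Variables (n : nat) (D : nat -> seq (label Pi)).
Hypothesis DP : forall t, contributors t (D t).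

Let ts := learn_times n.

(** Without a match [find] yields [size ts], the index of the additional last block; the same holds
    for [learn_block]. *)
Definition first_block l := find (fun t => l \in D t) ts.

Definition learn_block l := find (fun t => learner t == Some l) ts.

(** An operation contributes to the value that it learns itself. *)
Lemma first_le_learn_block l : first_block l <= learn_block l.
Proof. by apply: sub_find => t /eqP/learnerP/DP[]. Qed.

Lemma learn_blockE t l v : t < n -> ev x t = Learn l v -> learn_block l = index t ts.
Proof.
move=> tn et; apply: eq_in_find => t' _ /=.
apply/eqP/eqP => [/learnerP et'|->]; last by apply/learnerP; rewrite /learnt_value et.
exact: (learn_uniq exec et' et).
Qed.

Lemma mem_ts t l v : t < n -> ev x t = Learn l v -> t \in ts.
Proof. by move=> tn et; rewrite mem_learn_times tn /learner et. Qed.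

Lemma first_blockP l j : first_block l <= j -> j < size ts ->
  exists t, [/\ t \in ts, index t ts = first_block l & l \in D t].
Proof.
move=> lj jN; have fN := leq_ltn_trans lj jN.
exists (nth 0 ts (first_block l)); split; first exact: mem_nth.
  by rewrite index_uniq // uniq_learn_times.
by apply: (@nth_find _ 0 (fun t => l \in D t)); rewrite has_find.
Qed.

Lemma first_block_le l t : l \in D t -> t \in ts -> first_block l <= index t ts.
Proof.
move=> lD tts; rewrite leqNgt; apply/negP => /(before_find 0).
by rewrite nth_index // lD.
Qed.

Lemma learn_timeP t : t \in ts ->
  t < n /\ exists l, ev x t = Learn l (learnt_value t).
Proof.
rewrite mem_learn_times => /andP[-> ]; case e: learner => [l|] // _; split=> //.
by exists l; apply/learnerP.
Qed.

Lemma learn_times_mono t t' : t' \in ts -> t \in ts -> index t' ts <= index t ts ->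
  (learnt_value t' <= learnt_value t)%O.
Proof.
move=> t's tts le_i; apply: learnt_le_value.
exact: (sorted_leq_index learnt_le_trans learnt_le_refl (sorted_learn_times n)) le_i.
Qed.

(** Upper bound: an operation invoked up to this block contributes to a value learnt in such a
    block, and values increase along the blocks. Lower bound: each contributing proposal is an
    initial or earlier learnt state joined with the effect of one operation; the state is covered by
    induction, and the operation is invoked no later than this block. *)
Lemma cumulative_learnt t : t \in ts ->
  cumulative (operations x n) first_block (index t ts).+1 = learnt_value t.
Proof.
move: {2}(index t ts) (erefl (index t ts)) => j.
elim/ltn_ind: j t => j IHj t tj tts.
have [tn [l et]] := learn_timeP tts; have [_ DtP v_lub] := DP et.
have effect_le l' a t' : invoked_before x n l' a -> l' \in D t' -> t' \in ts ->
    (tau (init L) a <= learnt_value t')%O.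
  case=> i _ ei l'D /learn_timeP[t'n [l'' et']].
  have [_ /(_ _ l'D)[k [v' [kt' ek le_v' _]]] _] := DP et'.
  apply: le_trans le_v'; have [z [a' [[i' ik ei'] zP ->]]] := propose_inv exec ek.
  have [_ <-] := invoke_uniq exec ei ei'.
  have rz : reachable z.
    case: zP => [->|[m _ [lm /reachable_learnt//]]]; exact: ReachableInit.
  by rewrite -[prod_tau z a]/(tau (z : state L) a) (tau_reachable _ rz) leUr.
apply: le_anti; apply/andP; split.
  rewrite joins_lub (reachable_ge (reachable_learnt et)) /=.
  apply/allP => _ /mapP[[l' a] + ->]; rewrite mem_filter ltnS tj /= => /andP[l'j].
  move=> /mem_operations la.
  have jN : j < size ts by rewrite -tj index_mem.
  have [t' [t'ts t'E l'D]] := first_blockP l'j jN.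
  apply: le_trans (effect_le _ _ _ la l'D t'ts) _.
  by apply: learn_times_mono; rewrite // tj t'E.
apply: v_lub; first by apply/reachable_ge/reachable_cumulative.
move=> l' k v' l'D kt ek bk.
have [z [a [[i ik ei] zP ->]]] := propose_inv exec ek.
have [rz le_z] : reachable z /\
    (z <= cumulative (operations x n) first_block (index t ts).+1)%O.
  case: zP => [->|[m mk [lm em]]].
    split; first exact: ReachableInit.
    by apply/reachable_ge/reachable_cumulative.
  split; first exact: reachable_learnt em.
  have mt := ltn_trans mk kt; have mts := mem_ts (ltn_trans mt tn) em.
  have vm : learnt_value m = z by rewrite /learnt_value em.
  (* By validity the state on which the proposal was based lies below the learnt value; as it was
     also learnt earlier, its block comes strictly before. *)
  have lt_i : index m ts < index t ts.
    by apply: index_learn_times => //; rewrite vm; exact: bk em.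
  rewrite -vm -(IHj (index m ts)) // -?tj //.
  rewrite joins_lub reachable_ge /=; last exact: reachable_cumulative.
  apply/allP => _ /mapP[o + ->]; rewrite mem_filter => /andP[om oops].
  (* Reflexivity, read through [joins_lub], bounds every joined term by the join. *)
  have := lexx (cumulative (operations x n) first_block (index t ts).+1).
  rewrite {1}/cumulative joins_lub => /andP[_ /allP]; apply.
  by apply: map_f; rewrite mem_filter oops andbT (leq_trans om) // ltnS ltnW.
rewrite -[prod_tau z a]/(tau (z : state L) a) (tau_reachable _ rz) leUx le_z /=.
have := lexx (cumulative (operations x n) first_block (index t ts).+1).
rewrite {1}/cumulative joins_lub => /andP[_ /allP]; apply.
apply/mapP; exists (l', a) => //; rewrite mem_filter ltnS first_block_le //=.
by apply/mem_operations; exists i => //; apply: ltn_trans (ltn_trans kt tn).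
Qed.

(** Otherwise [l'] contributes to a value learnt at some time [t] whose block is not after that of
    [l]. Its proposal follows the learn event of [l], so by validity the value at [t] dominates the
    one learnt by [l], and the block of [t] comes strictly later. *)
Lemma return_before_invoke r i l l' b a : r < i < n ->
  ev x r = Return l b -> ev x i = Invoke l' a -> learn_block l < first_block l'.
Proof.
move=> /andP[ri iN] er ei; have [_ [v [j [_ jr ej _]]]] := return_inv exec er.
have jn := ltn_trans jr (ltn_trans ri iN); have jts := mem_ts jn ej.
rewrite (learn_blockE jn ej) ltnNge; apply/negP => le_f.
have jN : index j ts < size ts by rewrite index_mem.
have [t [tts tE l'D]] := first_blockP le_f jN.
have [tn [lt et]] := learn_timeP tts.
have [_ /(_ _ l'D)[k [v' [kt ek _ bk]]] _] := DP et.
have [z [a' [[i' ik ei'] _ _]]] := propose_inv exec ek.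
have [ii' _] := invoke_uniq exec ei ei'.
have jk : j < k by rewrite (ltn_trans jr) // (ltn_trans ri) // ii'.
have : index j ts < index t ts.
  apply: index_learn_times (ltn_trans jk kt) => //.
  by rewrite {1}/learnt_value ej; exact: bk ej.
by rewrite tE ltnNge le_f.
Qed.

(** Many events leave no action in the history, so a cut does not determine its time [m]; events are
    removed from the end until one fits. *)
Lemma history_split k H1 H2 : history x k = H1 ++ H2 ->
  exists m, [/\ m <= k, H1 = history x m &
    forall y, y \in H2 -> exists2 i, m <= i < k & event_action (ev x i) = Some y].
Proof.
elim: k H2 => [|k IHk] H2.
  by case: H1 H2 => [|? ?] [|? ?] //= _; exists 0.
case/lastP: H2 => [|H2 y]; first by rewrite cats0 => <-; exists k.+1.
rewrite historyS; case e: event_action => [y'|] /=; last first.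
  rewrite cats0 => /IHk[m [mk -> H2P]]; exists m; rewrite (leqW mk); split=> //.
  by move=> y' /H2P[i /andP[mi ik] ei]; exists i; rewrite // mi ltnW.
rewrite cats1 -rcons_cat => /rcons_inj[/IHk[m [mk -> H2P]] yE].
exists m; rewrite (leqW mk); split=> // y''; rewrite mem_rcons inE => /predU1P[->|].
  by exists k; rewrite ?mk ?ltnSn // -yE.
by move=> /H2P[i /andP[mi ik] ei]; exists i; rewrite // mi ltnW.
Qed.

Lemma history_linearizable :
  interval_linearizable (@iseq_spec Pi U _ L) (history x n).
Proof.
have bounds : {in operations x n, forall o,
    first_block o.1 <= learn_block o.1 < (size ts).+1}.
  by move=> o _; rewrite first_le_learn_block ltnS find_size.
pose out := outcome (operations x n) first_block learn_block.
(* The algorithm computes its output from the learnt value, which is the state after the block of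
   the learn event. *)
have outP r l b a : r < n -> ev x r = Return l b -> invoked_before x r l a ->
    out (l, a) = b.
  move=> rn er [i ir ei]; have [a' [v [j [[i' _ ei'] jr ej ->]]]] := return_inv exec er.
  have [_ <-] := invoke_uniq exec ei ei'; have jn := ltn_trans jr rn.
  rewrite /out /outcome /= (learn_blockE jn ej) cumulative_learnt ?(mem_ts jn ej) //.
  by rewrite /learnt_value ej.
have ltP r l b i l' a : r < i < n -> ev x r = Return l b ->
    ev x i = Invoke l' a -> learn_block l < first_block l'.
  exact: return_before_invoke.
have projP p := proj_history exec p outP ltP.
apply: interval_linearizable_slots bounds _ _.
- exact: uniq_operations.
- by move=> p; have [_ [q [w [e1 e2 _ _]]]] := projP p; exists q, w.
- by move=> p; have [] := projP p.
move=> l l' [H1 [H2 [b [a [eH lH1 l'H2]]]]].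
have [m [mn eH1 /(_ _ l'H2)[i iN ei]]] := history_split eH.
move: lH1; rewrite eH1 => /mem_history[r rm er].
apply: (@return_before_invoke r i l l' b a).
- by have /andP[mi ->] := iN; rewrite (leq_trans rm mi).
- by case: (ev x r) er => //= ? ? [-> ->].
- by case: (ev x i) ei => //= ? ? [-> ->].
Qed.
End Placement.
End LearntOrder.

(** * Termination of the operations of correct clients *)

Section Liveness.
Variables (Pi U : eqType) (dO dC : Order.disp_t).
Variables (Lo : LADT U dO) (Lc : configLADT Pi U dC) (x : run Lo Lc).
Hypotheses (exec : execution x).

(** The least time from [n] on with an event of [p] serves: before it, the local state cannot
    change. *)
Lemma next_event n m p : n <= m -> event_proc (ev x m) = Some p ->
  exists k, [/\ n <= k, event_proc (ev x k) = Some p & st x k p = st x n p].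
Proof.
move=> nm em; have ex : exists k, (n <= k) && (event_proc (ev x k) == Some p).
  by exists m; rewrite nm em eqxx.
case: (ex_minnP ex) => k /andP[nk /eqP ek] kmin; exists k; split=> //.
have : forall j, n <= j -> j <= k -> st x j p = st x n p; last by apply.
elim=> [|j IHj]; first by rewrite leqn0 => /eqP->.
rewrite leq_eqVlt => /predU1P[->//|nj jk].
rewrite (st_next exec) ?(IHj nj (ltnW jk)) //; apply/eqP => ej.
by have := kmin j; rewrite -ltnS nj ej eqxx leqNgt jk => /(_ isT).
Qed.

Lemma step_invoked (zO : state Lo) (zC : state Lc) (l : label Pi) a e s :
  local_step (Local zO zC (Invoked l a)) e s ->
  (exists v, e = Propose l v /\ s = Local zO zC (Proposing l a)) \/
  exists p, e = Crash p.
Proof.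
move s0E: (Local _ _ _) => s0 step; case: step s0E => //.
- by move=> zO' zC' l' a' [-> -> -> ->]; left; eexists.
- by move=> zO' zC' l' a' [-> -> -> ->]; left; eexists.
- by move=> zO' zC' f p _ _; right; exists p.
Qed.

Lemma step_proposing (zO : state Lo) (zC : state Lc) (l : label Pi) a e s :
  local_step (Local zO zC (Proposing l a)) e s ->
  (exists zO' zC', s = Local zO' zC' (Learnt l a)) \/ exists p, e = Crash p.
Proof.
move s0E: (Local _ _ _) => s0 step; case: step s0E => //.
- by move=> ? ? l' a' zO' zC' [_ _ -> ->]; left; exists zO', zC'.
- by move=> ? ? f p _ _; right; exists p.
Qed.

Lemma step_learnt (zO : state Lo) (zC : state Lc) (l : label Pi) a e s :
  local_step (Local zO zC (Learnt l a)) e s ->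
  (exists b, e = Return l b) \/ exists p, e = Crash p.
Proof.
move s0E: (Local _ _ _) => s0 step; case: step s0E => //.
- by move=> ? ? l' a' [_ _ -> _]; left; eexists.
- by move=> ? ? l' a' [_ _ -> _]; left; eexists.
- by move=> ? ? f p _ _; right; exists p.
Qed.

Hypotheses (live : reconfigurable_liveness x) (fairx : fair x).
Hypotheses (avail : configuration_availability x) (fin : finitely_many_configs x).

(** The phases are followed in turn: fairness yields the proposal, liveness of the RLA object the
    learnt value, and fairness again the response. Crashes are excluded since a correct client
    crashes only in phase [Ready]. *)
Lemma operation_returns n l a : ev x n = Invoke l a -> correct_client x l.1 ->
  exists2 m, n < m & exists b, ev x m = Return l b.
Proof.
move=> en correct; have ep : event_proc (ev x n) = Some l.1 by rewrite en.
have crash_ready m q : event_proc (ev x m) = Some l.1 -> ev x m = Crash q ->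
    phase_ (st x m l.1) = Ready Lo Lc.
  by move=> + em; rewrite em => -[qE]; apply: correct; rewrite em qE.
have [zO [zC st1]] : exists zO zC, st x n.+1 l.1 = Local zO zC (Invoked l a).
  have := step_event exec ep; rewrite en; move ee: (Invoke l a) => e step.
  by case: step ee => // zO zC l' a' [-> ->]; exists zO, zC.
have [m [nm em stm]] : exists m, [/\ n < m, event_proc (ev x m) = Some l.1 &
    st x m l.1 = st x n.+1 l.1].
  have := fairx n.+1 l.1; rewrite st1 /= => -[m nm em].
  have [|k [nk ek stk]] := @next_event n.+1 m l.1 nm; last by exists k; rewrite -st1.
  by case: em => [->|[v ->]].
have := step_event exec em; rewrite stm st1.
case/step_invoked => [[v [emE stmS]]|[q /(crash_ready _ _ em)]];
  last by rewrite stm st1.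
have [m' mm' [v' em']] := live avail fin emE correct.
(* The next event of the process is not assumed to be the one at [m']; its phase leaves only a
   learning step or a crash. *)
have [|k [mk ek stk]] := @next_event m.+1 m' l.1 mm'; first by rewrite em'.
have := step_event exec ek; rewrite stk stmS.
case/step_proposing => [[zO' [zC' stkS]]|[q /(crash_ready _ _ ek)]];
  last by rewrite stk stmS.
have [r kr er] : exists2 r, k.+1 <= r & event_proc (ev x r) = Some l.1.
  have := fairx k.+1 l.1; rewrite stkS /= => -[r kr er]; exists r => //.
  by case: er => [->|[b ->]].
have [i [ki ei sti]] := next_event kr er.
have := step_event exec ei; rewrite sti stkS.
case/step_learnt => [[b eib]|[q /(crash_ready _ _ ei)]]; last by rewrite sti stkS.
by exists i; [exact: ltn_trans (ltn_trans nm mk) ki | exists b].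
Qed.
End Liveness.

Theorem theorem6p1 (Pi U : eqType) (dO dC : Order.disp_t)
    (Lo : LADT U dO) (Lc : configLADT Pi U dC) (x : run Lo Lc) :
  execution x -> RLA x ->
  (forall n : nat,
     interval_linearizable (@iseq_spec Pi U _ (ladt_prod Lo Lc)) (history x n)) /\
  (fair x -> configuration_availability x -> finitely_many_configs x ->
   forall n (l : label Pi) a, ev x n = Invoke l a -> correct_client x l.1 ->
     exists2 m, (n < m)%N & exists b, ev x m = Return l b).
Proof.
move=> exec [valid consistent live]; split=> [n|fairx avail fin n l a].
  (* Choice fixes one list of contributors for each time, on which the placement in blocks
     depends. *)
  have [D DP] := choice (contributors_exist exec valid).
  exact: history_linearizable exec valid consistent n D DP.
exact: operation_returns.
Qed.
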